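(* Let $G$ be a finite groupoid. Then $\mathit{Half}(G)$ is a group (under composition of maps).
   Context: A groupoid is a nonempty set with a binary operation. A half-automorphism of a groupoid $(G,* )$ is a bijection $f:G\to G$ such that $f(x*y)\in\{f(x)*f(y),f(y)*f(x)\}$ for all $x,y\in G$. $\mathit{Half}(G)$ denotes the set of all half-automorphisms of $G$. *)

(* Defs.v *)
From mathcomp Require Import all_boot.
From mathcomp Require Import boolp classical_sets.

Set Implicit Arguments.
Unset Strict Implicit.
Unset Printing Implicit Defensive.

Local Open Scope classical_set_scope.

Definition half_automorphism (T : Type) (op : T -> T -> T) (f : T -> T) : Prop :=
  bijective f /\
  forall x y, f (op x y) = op (f x) (f y) \/ f (op x y) = op (f y) (f x).

Definition Half (T : Type) (op : T -> T -> T) : set (T -> T) :=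
  [set f | half_automorphism op f].

(* The subset A of M, with the restriction of mul, is a group.  This is stated
   on a subset because the bundled groupType has no unbundled counterpart for
   the set of all maps T -> T, which is not itself a group under composition. *)
Definition is_group (M : Type) (A : set M) (mul : M -> M -> M) : Prop :=
  [/\ forall a b, A a -> A b -> A (mul a b),
      forall a b c, A a -> A b -> A c -> mul a (mul b c) = mul (mul a b) c
    & exists2 e, A e &
        (forall a, A a -> mul e a = a /\ mul a e = a) /\
        (forall a, A a -> exists2 b, A b & mul b a = e /\ mul a b = e)].

(* Main.v *)
Require Import Defs.
From mathcomp Require Import all_boot.
From mathcomp Require Import boolp classical_sets.
From mathcomp Require Import fingroup perm.

(** Half-automorphisms are closed under composition. On a finite set a bijection
    has finite order, so its inverse is one of its iterates, hence again a
    half-automorphism. *)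

(** Only inverses need finiteness: the values of [f] at [op a b] and [op b a] may coincide, so
    [op (f a) (f b)] need not be either of them and the defining condition does not transfer
    directly to the inverse of [f]. *)

Lemma half_automorphism_id (T : Type) (op : T -> T -> T) :
  half_automorphism op id.
Proof. by split; [exists id | left]. Qed.

Lemma half_automorphism_comp (T : Type) (op : T -> T -> T) (f g : T -> T) :
  half_automorphism op f -> half_automorphism op g ->
  half_automorphism op (f \o g).
Proof.
move=> [bij_f hf] [bij_g hg]; split; first exact: bij_comp.
move=> x y /=; case: (hg x y) => ->; first exact: hf.
(* [g] has swapped the factors; a second swap by [f] restores their order. *)
by case: (hf (g y) (g x)) => ->; [right | left].
Qed.

Lemma half_automorphism_iter (T : Type) (op : T -> T -> T) (f : T -> T) n :
  half_automorphism op f -> half_automorphism op (iter n f).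
Proof.
move=> hf; elim: n => [|n IHn]; first exact: half_automorphism_id.
exact: (half_automorphism_comp _ _ _ _ hf IHn).
Qed.

Lemma injective_iter_id (T : finType) (f : T -> T) :
  injective f -> exists n, forall x, iter n.+1 f x = x.
Proof.
(* The order of [f] as a permutation is positive, so it is the successor of this [n]; [iter n f]
   then inverts [f]. *)
move=> inj_f; exists #[perm inj_f]%g.-1 => x.
rewrite prednK ?order_gt0 // -(eq_iter (permE inj_f)) -permX expg_order.
exact: perm1.
Qed.

Theorem corollary3p5 (T : finType) (op : T -> T -> T) (hT : inhabited T) :
  is_group (Half op) (fun f g : T -> T => f \o g).
Proof.
split; [exact: half_automorphism_comp | by [] |].
exists id; first exact: half_automorphism_id.
split=> // f hf; have [n iter_f] := injective_iter_id _ _ (bij_inj hf.1).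
exists (iter n f); first exact: half_automorphism_iter.
by split; apply: funext => x /=; rewrite -?iterSr -?iterS iter_f.
Qed.
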